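(* Let $G$ be a finite simple graph of order $n$, let $W$ and $X$ be non-empty subsets of $V(G)$, let $G_W$ be the graph obtained from $G$ by attaching a self-loop at each vertex of $W$, and let $(G_W)^X$ be the self-loop graph obtained from $G_W$ by looped Seidel switching with respect to $X$. Then the Seidel matrices $S((G_W)^X)$ and $S(G_W)$ have the same spectrum (as multisets of eigenvalues), and $$\mathcal{SE}((G_W)^X)=\mathcal{SE}(G_W).$$
   Context: The Seidel matrix $S(G)=[s_{ij}]$ of a simple graph $G$ with vertices $v_1,\dots,v_n$ is the real symmetric $n\times n$ matrix with $s_{ii}=0$ for all $i$ and, for $i\ne j$, $s_{ij}=-1$ if $v_i,v_j$ are adjacent and $s_{ij}=1$ if they are non-adjacent. For $W\subseteq V(G)$ with $|W|=\sigma$, the Seidel matrix of the self-loop graph $G_W$ is $S(G_W)=S(G)-\mathfrak{I}_W$, where $\mathfrak{I}_W$ is the diagonal $n\times n$ matrix whose $(i,i)$ entry is $1$ if $v_i\in W$ and $0$ otherwise. The Seidel energy of $G_W$, a self-loop graph with $n$ vertices and $\sigma$ loops, is $\mathcal{SE}(G_W)=\sum_{i=1}^n\left|\theta_i(G_W)+\frac{\sigma}{n}\right|$, where $\theta_1(G_W),\dots,\theta_n(G_W)$ are the eigenvalues of $S(G_W)$ (with multiplicity). The same definitions apply to any self-loop graph, with $\sigma$ its number of loops. The looped Seidel switching of $G_W$ with respect to $X\subseteq V(G)$ is the self-loop graph $(G_W)^X$ obtained from $G_W$ by complementing all adjacencies between $X$ and $V(G)\setminus X$ (edges between these two sets become non-edges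 and vice versa), while leaving adjacencies inside $X$ and inside $V(G)\setminus X$ unchanged; the loops are unchanged, i.e. a vertex has a loop in $(G_W)^X$ if and only if it has one in $G_W$. *)

(* Defs.v *)
From HB Require Import structures.
From mathcomp Require Import all_boot all_order all_algebra.
From mathcomp Require Import polyrcf complex.

Set Implicit Arguments.
Unset Strict Implicit.
Unset Printing Implicit Defensive.

Import Order.TTheory GRing.Theory Num.Theory.
Local Open Scope ring_scope.

(* The real eigenvalues of A, each repeated according to its algebraic
   multiplicity. When A is symmetric these are all its eigenvalues: see
   char_poly_spectrum and size_spectrum below. *)
Definition spectrum (R : rcfType) (n : nat) (A : 'M[R]_n) : seq R :=
  let p := char_poly A in
  flatten [seq nseq (mup x p) x | x <- rootsR p].

Lemma count_spectrum (R : rcfType) (n : nat) (A : 'M[R]_n) (x : R) :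
  count_mem x (spectrum A) = mup x (char_poly A).
Proof.
have p0 : char_poly A != 0 by rewrite monic_neq0 ?char_poly_monic.
rewrite /spectrum; set p := char_poly A in p0 *.
rewrite count_flatten -map_comp sumnE big_map.
under eq_bigr => y _ do rewrite /= count_nseq /=.
have uR : uniq (rootsR p) by rewrite uniq_roots.
have rootE y : (y \in rootsR p) = root p y.
  by rewrite -roots_on_rootsR //= in_itv.
case: (boolP (x \in rootsR p)) => [xp|xNp].
  rewrite (bigD1_seq x) //= eqxx mul1n big1 ?addn0 // => y /negPf yx.
  by rewrite yx mul0n.
rewrite mupNroot -?rootE // big_seq big1 // => y yp.
by case: eqP => [yx|_]; rewrite ?mul0n // -yx yp in xNp.
Qed.

Lemma char_poly_spectrum (R : rcfType) (n : nat) (A : 'M[R]_n) :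
  A^T = A -> char_poly A = \prod_(x <- spectrum A) ('X - x%:P).
Proof.
move=> symA.
suff [s Es] : exists s : seq R, char_poly A = \prod_(x <- s) ('X - x%:P).
  rewrite [LHS]Es; apply: perm_big; apply/allP => x _.
  by apply/eqP; rewrite /= count_spectrum Es mu_prod_XsubC.
pose B := map_mx (real_complex R) A.
have hB : B \is hermsymmx.
  apply: realsym_hermsym.
    apply/is_hermitianmxP; rewrite expr0 scale1r map_mx_id //.
    by rewrite /B map_trmx symA.
  by apply/mxOverP => i j; rewrite mxE complex_real.
have dR := hermitian_spectral_diag_real hB.
have /orthomx_spectralP EB := hermitian_normalmx hB.
set P := spectralmx B in EB; set d := spectral_diag B in EB dR.
have uP : P \in unitmx := spectral_unit B.
have cB : char_poly B = \prod_(i < n) ('X - (d 0 i)%:P).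
  transitivity (char_poly (diag_mx d)); last first.
    rewrite char_poly_trig ?diag_mx_is_trig //.
    by apply: eq_bigr => i _; rewrite mxE eqxx mulr1n.
  rewrite /char_poly /char_poly_mx EB !map_mxM /=.
  pose Q := map_mx (polyC : R[i] -> {poly R[i]}) P.
  pose Q' := map_mx (polyC : R[i] -> {poly R[i]}) (invmx P).
  have QQ : Q' *m Q = 1%:M by rewrite -map_mxM mulVmx // map_mx1.
  have EX : ('X)%:M = Q' *m ('X)%:M *m Q by rewrite scalar_mxC -mulmxA QQ mulmx1.
  rewrite {1}EX -mulmxBl -mulmxBr !det_mulmx mulrAC -det_mulmx.
  by rewrite QQ det1 mul1r.
exists [seq complex.Re (d 0 i) | i <- enum 'I_n].
apply: (map_inj_poly (@complexI R) (rmorph0 _)).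
rewrite map_char_poly -/B cB rmorph_prod big_map big_enum /=.
apply: eq_bigr => i _; rewrite map_polyXsubC /= RRe_real //.
by move/mxOverP: dR; apply.
Qed.

Lemma size_spectrum (R : rcfType) (n : nat) (A : 'M[R]_n) :
  A^T = A -> size (spectrum A) = n.
Proof.
move/char_poly_spectrum/(congr1 (fun p : {poly R} => size p)).
by rewrite size_char_poly size_prod_XsubC => -[].
Qed.

Record sgraph (T : finType) := SGraph {
  adj :> rel T;
  adj_sym : symmetric adj;
  adj_irr : irreflexive adj
}.

Record loop_graph (T : finType) := LoopGraph {
  base : sgraph T;
  loops : {set T}
}.

Definition attach_loops (T : finType) (G : sgraph T) (W : {set T}) :
  loop_graph T := LoopGraph G W.

Section Switching.
Variables (T : finType) (G : sgraph T) (X : {set T}).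

Definition switch_rel : rel T := fun u v =>
  if (u \in X) != (v \in X) then ~~ adj G u v else adj G u v.

Lemma switch_rel_sym : symmetric switch_rel.
Proof. by move=> u v; rewrite /switch_rel eq_sym adj_sym. Qed.

Lemma switch_rel_irr : irreflexive switch_rel.
Proof. by move=> u; rewrite /switch_rel eqxx adj_irr. Qed.

Definition switch : sgraph T := SGraph switch_rel_sym switch_rel_irr.
End Switching.

Definition loop_switch (T : finType) (H : loop_graph T) (X : {set T}) :
  loop_graph T := LoopGraph (switch (base H) X) (loops H).

(* The vertices are numbered by enum_val : 'I_#|T| -> T. *)
Definition seidel_mx (R : rcfType) (T : finType) (G : sgraph T) :
  'M[R]_#|T| :=
  \matrix_(i, j) if i == j then 0
                 else if adj G (enum_val i) (enum_val j) then -1 else 1.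

Definition loop_mx (R : rcfType) (T : finType) (W : {set T}) : 'M[R]_#|T| :=
  diag_mx (\row_i (enum_val i \in W)%:R).

Definition loop_seidel_mx (R : rcfType) (T : finType) (H : loop_graph T) :
  'M[R]_#|T| := seidel_mx R (base H) - loop_mx R (loops H).

Lemma loop_seidel_mx_sym (R : rcfType) (T : finType) (H : loop_graph T) :
  (loop_seidel_mx R H)^T = loop_seidel_mx R H.
Proof.
rewrite /loop_seidel_mx raddfB /= /loop_mx tr_diag_mx; congr (_ - _).
by apply/matrixP => i j; rewrite !mxE eq_sym adj_sym.
Qed.

Definition seidel_energy (R : rcfType) (T : finType) (H : loop_graph T) : R :=
  \sum_(t <- spectrum (loop_seidel_mx R H)) `|t + #|loops H|%:R / #|T|%:R|.

(* Main.v *)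
(** Switching with respect to X conjugates the Seidel matrix by the diagonal
    sign matrix D with -1 exactly on X. The loop matrix is diagonal, so
    D commutes with it, and D is an involution: S((G_W)^X) = D S(G_W) D^-1. *)

Require Import Defs.
From mathcomp Require Import all_boot all_order all_algebra.

Import GRing.Theory.
Local Open Scope ring_scope.

(** Since ['X%:M] is scalar, conjugation fixes it; the whole characteristic matrix is conjugated,
    and the determinants of [Q'] and [P'] cancel. *)
Lemma char_poly_conjmx (R : comNzRingType) (n : nat) (P Q A : 'M[R]_n) :
  Q *m P = 1%:M -> char_poly (Q *m A *m P) = char_poly A.
Proof.
move=> QP; rewrite /char_poly /char_poly_mx !map_mxM /=.
set P' := map_mx polyC P; set Q' := map_mx polyC Q.
have QP' : Q' *m P' = 1%:M by rewrite -map_mxM QP map_mx1.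
have {1}-> : 'X%:M = Q' *m 'X%:M *m P'
  by rewrite scalar_mxC -mulmxA QP' mulmx1.
by rewrite -mulmxBl -mulmxBr !det_mulmx mulrAC -det_mulmx QP' det1 mul1r.
Qed.

Definition switch_sign_mx (R : comNzRingType) (T : finType) (X : {set T}) :
    'M[R]_#|T| :=
  diag_mx (\row_i (-1) ^+ (enum_val i \in X)).

Lemma switch_sign_mx_invol (R : comNzRingType) (T : finType) (X : {set T}) :
  switch_sign_mx R T X *m switch_sign_mx R T X = 1%:M.
Proof.
rewrite mulmx_diag -[1%:M]diag_const_mx; congr diag_mx.
by apply/rowP => i; rewrite !mxE -expr2 sqrr_sign.
Qed.

Lemma loop_seidel_mx_switch (R : rcfType) (T : finType) (H : loop_graph T)
    (X : {set T}) :
  loop_seidel_mx R (loop_switch H X) =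
  switch_sign_mx R T X *m loop_seidel_mx R H *m switch_sign_mx R T X.
Proof.
apply/matrixP => i j; rewrite mul_mx_diag mxE mul_diag_mx !mxE /=.
have [->|_] := eqVneq i j.
  (* On the diagonal the sign occurs squared, so the loop entry survives. *)
  by rewrite mulrAC -expr2 sqrr_sign mul1r.
(* Off the diagonal the loop term vanishes, and the two signs multiply to -1 exactly when one of the
   two vertices lies in [X]. *)
rewrite !mulr0n !subr0 /switch_rel.
by case: (enum_val i \in X); case: (enum_val j \in X); case: (adj _ _ _) => /=;
  rewrite ?expr0 ?expr1 ?mulN1r ?mulrN1 ?mul1r ?mulr1 ?opprK.
Qed.

(** [spectrum] is computed from [char_poly] alone, hence an equality of lists. *)
Lemma spectrum_loop_switch (R : rcfType) (T : finType) (H : loop_graph T)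
    (X : {set T}) :
  spectrum (loop_seidel_mx R (loop_switch H X)) =
  spectrum (loop_seidel_mx R H).
Proof.
by rewrite /spectrum loop_seidel_mx_switch char_poly_conjmx //
  switch_sign_mx_invol.
Qed.

Theorem theorem4p4 (R : rcfType) (T : finType) (G : sgraph T) (W X : {set T})
    (W_neq0 : W != set0) (X_neq0 : X != set0) :
  perm_eq (spectrum (loop_seidel_mx R (loop_switch (attach_loops G W) X)))
          (spectrum (loop_seidel_mx R (attach_loops G W)))
  /\ seidel_energy R (loop_switch (attach_loops G W) X)
     = seidel_energy R (attach_loops G W).
Proof.
(* Switching keeps the loop set by definition, so the shifts in both energies agree. *)
by rewrite /seidel_energy spectrum_loop_switch; split.
Qed.
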